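(* Let $K$ be a compact space such that $\mathcal{C}(K)$ admits an equivalent norm whose dual norm on $\mathcal{C}(K)^*$ is locally uniformly rotund. Then $\mathcal{C}(K)$ admits an equivalent norm which is of class $\mathcal{C}^\infty$ on $\mathcal{C}(K)\setminus\{0\}$.
   Context: Compact spaces are Hausdorff. $\mathcal{C}(K)$ is the Banach space of continuous real-valued functions on $K$ with the supremum norm; ''equivalent'' means equivalent to the supremum norm, and smoothness is in the Fréchet sense. A norm $\|\cdot\|$ on a vector space $Y$ is locally uniformly rotund (LUR) if whenever $y,y_n\in Y$ satisfy $\|y\|=\|y_n\|=1$ and $\|y+y_n\|\to 2$, one has $\|y_n-y\|\to 0$. *)

(* Defs.v *)
From HB Require Import structures.
From mathcomp Require Import all_boot all_order all_algebra.
From mathcomp Require Import all_classical all_reals all_analysis.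
Set Implicit Arguments.
Unset Strict Implicit.
Unset Printing Implicit Defensive.
Import Order.TTheory GRing.Theory Num.Theory.
Import numFieldNormedType.Exports.
Local Open Scope classical_set_scope.
Local Open Scope ring_scope.

Section cspace_lmodule.
Variables (R : realType) (K : topologicalType).

Definition cts_pred : {pred K -> R} := mem [set f : K -> R | continuous f].

Section Sub.
Context (f : K -> R) (fP : f \in cts_pred).
#[local] HB.instance Definition _ := @isContinuous.Build K R f (set_mem fP).
Definition cts_Sub : continuousType K R := f.
End Sub.

Lemma cts_rect (P : continuousType K R -> Type) :
  (forall f (Pf : f \in cts_pred), P (cts_Sub Pf)) -> forall u, P u.
Proof.
move=> Psub [f [[Pf]]]/=.
by suff -> : Pf = (set_mem (@mem_set _ [set f | _] f Pf)) by apply: Psub.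
Qed.

Lemma cts_valP f (Pf : f \in cts_pred) : cts_Sub Pf = f :> (_ -> _).
Proof. by []. Qed.

HB.instance Definition _ :=
  isSub.Build _ _ (continuousType K R) cts_rect cts_valP.

Lemma cts_submod_closed : submod_closed cts_pred.
Proof.
split=> [|a f g]; first by rewrite inE => x; exact: cvg_cst.
rewrite !inE => cf cg x; apply: (@continuousD _ _ _ (a *: f) g) (cg x).
by apply: continuousZr; exact: cf.
Qed.

HB.instance Definition _ :=
  GRing.isSubmodClosed.Build R (K -> R) cts_pred cts_submod_closed.
HB.instance Definition _ :=
  [SubChoice_isSubLmodule of continuousType K R by <:].

End cspace_lmodule.

(* The sup norm is a norm on C(K) only for K compact, hence an alias that carries
   the compactness proof. *)
Definition cspace (R : realType) (K : topologicalType)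
  (_ : compact [set: K]) : Type := continuousType K R.

Section cspace_normed.
Variables (R : realType) (K : topologicalType) (cK : compact [set: K]).
Local Notation CK := (cspace R cK).

HB.instance Definition _ := GRing.Lmodule.copy CK (continuousType K R).

Definition supnorm (f : CK) : R := sup [set `|f x| | x in [set: K]].

Lemma supnorm_has_ubound (f : CK) :
  has_ubound [set `|f x| | x in [set: K]].
Proof.
have /compact_bounded[M [_ Mf]] : compact (f @` [set: K]).
  apply: continuous_compact => //; apply: continuous_subspaceT.
  exact: (@cts_fun _ _ (f : continuousType K R)).
exists (M + 1) => _ [x _ <-]; apply: (Mf (M + 1)); first by rewrite ltrDl.
by exists x.
Qed.

Lemma le_supnorm (f : CK) x : `|f x| <= supnorm f.
Proof. by apply: (ub_le_sup (supnorm_has_ubound f)); exists x. Qed.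

Lemma supnorm_ge0 (f : CK) : 0 <= supnorm f.
Proof.
have [f0|/set0P[_ [x _ _]]] :=
    eqVneq [set `|f x| | x in [set: K]] set0.
  by rewrite /supnorm f0 sup0.
by rewrite (le_trans _ (le_supnorm f x)).
Qed.

Lemma supnorm_le (f : CK) M : 0 <= M ->
  (forall x, `|f x| <= M) -> supnorm f <= M.
Proof.
move=> M0 fM; rewrite /supnorm.
have [->|/set0P ne] := eqVneq [set `|f x| | x in [set: K]] set0.
  by rewrite sup0.
by apply: ge_sup => // _ [x _ <-].
Qed.

Lemma supnormD (f g : CK) : supnorm (f + g) <= supnorm f + supnorm g.
Proof.
apply: supnorm_le => [|x]; first by rewrite addr_ge0 ?supnorm_ge0.
by rewrite (le_trans (ler_normD _ _))// lerD ?le_supnorm.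
Qed.

Lemma supnormZ_le (a : R) (f : CK) : supnorm (a *: f) <= `|a| * supnorm f.
Proof.
apply: supnorm_le => [|x]; first by rewrite mulr_ge0 ?supnorm_ge0.
by rewrite normrM ler_wpM2l ?le_supnorm.
Qed.

Lemma supnormZ (a : R) (f : CK) : supnorm (a *: f) = `|a| * supnorm f.
Proof.
apply/eqP; rewrite eq_le supnormZ_le/=; have [->|a0] := eqVneq a 0.
  by rewrite normr0 mul0r supnorm_ge0.
rewrite -ler_pdivlMl ?normr_gt0// -normfV.
by rewrite (le_trans _ (supnormZ_le _ _))// scalerA mulVf// scale1r.
Qed.

Lemma supnorm0_eq0 (f : CK) : supnorm f = 0 -> f = 0.
Proof.
move=> f0; apply/(@continuousEP K R) => x; apply/eqP.
by rewrite -normr_le0 -f0; exact: le_supnorm.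
Qed.

HB.instance Definition _ :=
  Lmodule_isNormed.Build R CK supnormD supnormZ supnorm0_eq0.

Lemma cspace_normE (f : CK) : `|f| = sup [set `|f x| | x in [set: K]].
Proof. by []. Qed.

End cspace_normed.

#[short(type="clinType")]
HB.structure Definition ContinuousLinear (R : realType)
    (V W : normedModType R) :=
  {f of @GRing.Linear R V W *:%R f & @isContinuous V W f}.

(* [N] need not be the canonical norm of [V]: with [N] the canonical norm this
   is the usual operator norm, and with [N] an equivalent norm and [W] the
   scalars it is the norm dual to [N]. *)
Definition opnorm (R : realType) (V W : normedModType R) (N : V -> R)
  (phi : V -> W) : R := sup [set `|phi x| | x in [set x | N x <= 1]].

Section clin.
Variables (R : realType) (V W : normedModType R).
Local Notation L := (clinType V W).

Definition clin_pred : {pred V -> W} :=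
  mem [set f : V -> W | linear f /\ continuous f].

Section Sub.
Context (f : V -> W) (fP : f \in clin_pred).
#[local] HB.instance Definition _ :=
  @GRing.isLinear.Build R V W *:%R f (set_mem fP).1.
#[local] HB.instance Definition _ := @isContinuous.Build V W f (set_mem fP).2.
Definition clin_Sub : L := f.
End Sub.

Lemma clin_predP (u : L) : (u : V -> W) \in clin_pred.
Proof. by rewrite inE; split; [exact: linearP|exact: cts_fun]. Qed.

Lemma clin_eqP (u v : L) : (u : V -> W) = v -> u = v.
Proof.
case: u v => [f [[fa] [fs] [fc]]] [g [[ga] [gs] [gc]]]/= fg.
move: fa fs fc; rewrite fg => fa fs fc.
by rewrite (Prop_irrelevance fa ga) (Prop_irrelevance fs gs)
  (Prop_irrelevance fc gc).
Qed.

Lemma clin_rect (P : L -> Type) :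
  (forall f (Pf : f \in clin_pred), P (clin_Sub Pf)) -> forall u, P u.
Proof.
move=> Psub u.
by rewrite -[u](@clin_eqP (clin_Sub (clin_predP u)) u erefl); exact: Psub.
Qed.

Lemma clin_valP f (Pf : f \in clin_pred) : clin_Sub Pf = f :> (_ -> _).
Proof. by []. Qed.

HB.instance Definition _ := isSub.Build _ _ L clin_rect clin_valP.
HB.instance Definition _ := [Choice of L by <:].

Lemma clin_submod_closed : submod_closed clin_pred.
Proof.
split=> [|a f g].
  rewrite inE; split=> [k x y|x]; last exact: cvg_cst.
  by rewrite /GRing.zero/= scaler0 addr0.
rewrite !inE => -[lf cf] [lg cg]; split=> [k x y|x].
  rewrite !fctE lf lg !scalerDr !scalerA addrACA.
  by rewrite [a * k]mulrC.
by apply: cvgD; [apply: cvgZl_tmp; exact: cf|exact: cg].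
Qed.

HB.instance Definition _ :=
  GRing.isSubmodClosed.Build R (V -> W) clin_pred clin_submod_closed.
HB.instance Definition _ := [SubChoice_isSubLmodule of L by <:].

Definition clin_norm (u : L) : R := opnorm (fun x : V => `|x|) u.

Lemma clin_bound (u : L) : exists2 M, 0 <= M & forall x, `|u x| <= M * `|x|.
Proof.
have /linear_boundedP := @continuous_linear_bounded _ _ _ 0 u (@cts_fun _ _ u 0).
by move=> /pinfty_ex_gt0[r r0 ur]; exists r => //; exact: ltW.
Qed.

Lemma clin_norm_has_sup (u : L) :
  has_sup [set `|u x| | x in [set x | `|x| <= 1]].
Proof.
split; first by exists `|u 0|, 0 => //=; rewrite normr0.
have [M M0 uM] := clin_bound u; exists M => _ [x /= x1 <-].
by rewrite (le_trans (uM x))// ler_piMr.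
Qed.

Lemma le_clin_norm1 (u : L) x : `|x| <= 1 -> `|u x| <= clin_norm u.
Proof.
by move=> x1; apply: (ub_le_sup (clin_norm_has_sup u).2); exists x.
Qed.

Lemma clin_norm_ge0 (u : L) : 0 <= clin_norm u.
Proof. by rewrite (le_trans _ (@le_clin_norm1 u 0 _)) ?normr0. Qed.

Lemma le_clin_norm (u : L) x : `|u x| <= clin_norm u * `|x|.
Proof.
have [->|x0] := eqVneq x 0; first by rewrite linear0 !normr0 mulr0.
have n0 : 0 < `|x| by rewrite normr_gt0.
rewrite -ler_pdivrMr// mulrC -[in X in X * _](normr_id x) -normfV.
rewrite -normrZ -linearZ; apply: le_clin_norm1.
by rewrite normrZ normfV normr_id mulVf ?gt_eqF.
Qed.

Lemma clin_norm_le (u : L) M :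
  (forall x, `|x| <= 1 -> `|u x| <= M) -> clin_norm u <= M.
Proof.
move=> uM; apply: ge_sup; first exact: (clin_norm_has_sup u).1.
by move=> _ [x x1 <-]; exact: uM.
Qed.

Lemma clin_normD (u v : L) : clin_norm (u + v) <= clin_norm u + clin_norm v.
Proof.
apply: clin_norm_le => x x1.
by rewrite (le_trans (ler_normD _ _))// lerD ?le_clin_norm1.
Qed.

Lemma clin_normZ_le (a : R) (u : L) : clin_norm (a *: u) <= `|a| * clin_norm u.
Proof.
apply: clin_norm_le => x x1.
by rewrite normrZ ler_wpM2l// le_clin_norm1.
Qed.

Lemma clin_normZ (a : R) (u : L) : clin_norm (a *: u) = `|a| * clin_norm u.
Proof.
apply/eqP; rewrite eq_le clin_normZ_le/=; have [->|a0] := eqVneq a 0.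
  by rewrite normr0 mul0r clin_norm_ge0.
rewrite -ler_pdivlMl ?normr_gt0// -normfV.
by rewrite (le_trans _ (clin_normZ_le _ _))// scalerA mulVf// scale1r.
Qed.

Lemma clin_norm0_eq0 (u : L) : clin_norm u = 0 -> u = 0.
Proof.
move=> u0; apply: clin_eqP; apply/funext => x; apply/eqP.
by rewrite -normr_le0 (le_trans (le_clin_norm u x))// u0 mul0r.
Qed.

HB.instance Definition _ :=
  Lmodule_isNormed.Build R L clin_normD clin_normZ clin_norm0_eq0.

Lemma clin_normE (u : L) : `|u| = sup [set `|u x| | x in [set x | `|x| <= 1]].
Proof. by []. Qed.

End clin.

Section norms.
Variable R : realType.

Definition is_norm (Y : lmodType R) (N : Y -> R) : Prop :=
  [/\ forall x y, N (x + y) <= N x + N y,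
      forall (a : R) x, N (a *: x) = `|a| * N x
    & forall x, N x = 0 -> x = 0].

Definition equivalent_norm (V : normedModType R) (N : V -> R) : Prop :=
  is_norm N /\
  exists c C : R, [/\ 0 < c, 0 < C & forall x, c * `|x| <= N x <= C * `|x|].

Definition dual_norm (V : normedModType R) (N : V -> R) :
  clinType V R^o -> R := fun phi => opnorm N phi.

Definition LUR (Y : lmodType R) (N : Y -> R) : Prop :=
  forall (y : Y) (y_ : nat -> Y),
    N y = 1 -> (forall n, N (y_ n) = 1) ->
    N (y + y_ n) @[n --> \oo] --> (2 : R) ->
    N (y_ n - y) @[n --> \oo] --> (0 : R).

(* [f] is of class C^n on [U], in the Frechet sense; meant for [U] open. The
   values of [Df] outside [U] are irrelevant. *)
Fixpoint class_C (V : normedModType R) (n : nat) (W : normedModType R)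
    (f : V -> W) (U : set V) {struct n} : Prop :=
  match n with
  | 0 => forall x, U x -> {for x, continuous f}
  | m.+1 => exists Df : V -> clinType V W,
      (forall x, U x -> is_diff x f (Df x)) /\
      @class_C V m (clinType V W) Df U
  end.

Definition class_Coo (V W : normedModType R) (f : V -> W) (U : set V) : Prop :=
  forall n, class_C n f U.

End norms.

(* Main.v *)
Require Import Defs.
From HB Require Import structures.
From mathcomp Require Import all_boot all_order all_algebra.
From mathcomp Require Import all_classical all_reals all_analysis.
From mathcomp Require Import ring lra.
Import Order.TTheory GRing.Theory Num.Theory.
Import numFieldNormedType.Exports.
Set Implicit Arguments.
Unset Strict Implicit.
Unset Printing Implicit Defensive.
Local Open Scope classical_set_scope.
Local Open Scope ring_scope.

(** Let a t be the dual norm of the evaluation at t and let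
    l_t f = f t / a t, a functional of dual norm 1. The evaluations at distinct
    points are uniformly far apart, so local uniform rotundity of the dual norm
    provides, for each t, a number gap t > 0 such that the dual norm of
    l_t + l_s is at most 2 - 2 * gap t for all s other than t ([neval_gap]).

    This makes the family (l_t) locally finite in the following sense
    ([neval_locally_finite]): if |l_t f| < 1 for all t, then there are a
    neighbourhood of f and a finite set T of points such that
    |l_t h| <= 1 - gap t for all h in the neighbourhood and all t outside T.
    Indeed, if this failed, then near some point s there would be points t
    other than s at which |l_t h| > 1 - gap t with h close to f. As a t is not
    much smaller than a s, while |h t| stays away from a s, gap t cannot be
    small. But a s / a t is at least 1 - gap t, so a function that nearly norms
    the evaluation at s takes on l_t + l_s a value near 2 - gap t or above,
    which contradicts the choice of gap t ([neval_isolated]).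

    Choose even, convex, smooth functions b_t on the line which vanish for
    |z| <= 1 - gap t and exceed 1 for 1 <= |z|. The required norm is the
    gauge of the convex body of all f such that sum_t b_t (l_t f) <= 1. Every f in
    the body satisfies |l_t f| < 1 for all t, so by local finiteness the sum
    over all points is, near f, a sum over a fixed finite set. Hence, near each
    nonzero f, the gauge N solves an equation sum_(t in T) b_t (l_t f / N f) = 1
    with finite T ([gauge_boundary]).

    Smoothness of such an N ([implicit_norm_class_C]) rests on two remarks.
    First, convexity of the b_t provides an explicit functional supporting N at
    each point; it depends continuously on the point, so it is the derivative
    of N. Second, the coefficients of this derivative are expressions in N, the
    l_t and the derivatives of the b_t, so they belong to a class of functions
    closed under taking gradients, and a function in such a class is of class
    C^n for all n ([comb_class_C]). For the b_t one uses x e^(-1/x), whose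
    derivatives are combinations of the functions x^-k e^(-1/x). *)

(** * A flat convex function *)

Section flat.
Context {R : realType}.
Implicit Types x y z t : R.

(** On the positive reals the derivative of x^-k e^(-1/x) is
    x^-(k+2) e^(-1/x) - k x^-(k+1) e^(-1/x), so the span of this one family is
    closed under differentiation, and the smoothness of its members follows
    from first derivatives alone. *)
Definition flat (k : nat) (x : R) : R :=
  if 0 < x then x ^- k * expR (- x^-1) else 0.

Lemma flat_ge0 k x : 0 <= flat k x.
Proof.
rewrite /flat; case: ifP => // x0.
by rewrite mulr_ge0 ?expR_ge0// invr_ge0 exprn_ge0// ltW.
Qed.

Lemma flat_le0 k x : x <= 0 -> flat k x = 0.
Proof. by rewrite /flat leNgt; case: ifP. Qed.

(** With u = 1 / (m x), the inequality u <= e^u raised to the power m = k + 2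
    beats x^-k by a factor x^2; a factor better than x is what gives derivative
    0 at the origin. *)
Lemma flat_bound k : exists2 C : R, 0 < C & forall x, flat k x <= C * x ^+ 2.
Proof.
pose m := k.+2; exists (m%:R ^+ m); first by rewrite exprn_gt0// ltr0n.
move=> x; rewrite /flat; case: ifP => [x0|_]; last first.
  by rewrite mulr_ge0 ?sqr_ge0// exprn_ge0.
pose u : R := x^-1 / m%:R.
have m0 : (0 : R) < m%:R by rewrite ltr0n.
have u0 : 0 < u by rewrite divr_gt0// invr_gt0.
have -> : - x^-1 = m%:R * (- u) by rewrite mulrN mulrC divfK// gt_eqF.
rewrite expRM_natl expRN exprVn.
have ue : u ^+ m <= expR u ^+ m.
  apply: lerXn2r; rewrite ?nnegrE ?expR_ge0 ?(ltW u0)//.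
  by apply: le_trans (expR_ge1Dx u); rewrite lerDr.
apply: (@le_trans _ _ (x ^- k / u ^+ m)).
  rewrite ler_wpM2l ?invr_ge0 ?exprn_ge0 ?(ltW x0)//.
  by rewrite lef_pV2// posrE exprn_gt0// expR_gt0.
rewrite /u expr_div_n invf_div exprVn invrK /m !exprS.
have xk : x ^+ k != 0 by rewrite expf_neq0// gt_eqF.
by rewrite le_eqVlt; apply/orP; left; apply/eqP; field.
Qed.

Lemma is_derive_flat k x :
  is_derive x 1 (flat k) (flat k.+2 x - k%:R * flat k.+1 x).
Proof.
have [x0|x0|->] := ltgtP x 0.
- rewrite !flat_le0 ?ltW// mulr0 subr0.
  apply: near_eq_is_derive (is_derive_cst (0 : R) x 1).
  near=> y; rewrite flat_le0// ltW//; near: y; exact: lt_nbhsl.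
- have xn0 : x != 0 by rewrite gt_eqF.
  apply: (@near_eq_is_derive _ _ _ (fun y => (y^-1) ^+ k * expR (- y^-1))).
    near=> y; rewrite /flat ifT ?exprVn//; near: y; exact: lt_nbhsr.
  have dV : is_derive x 1 (fun y : R => y^-1) (- x ^- 2).
    apply: DeriveDef; first exact: derivableV.
    by rewrite deriveV// derive_id scaler1.
  have dX : is_derive x 1 (fun y : R => y^-1 ^+ k)
      (k%:R * x^-1 ^+ k.-1 * - x ^- 2).
    have -> : (fun y : R => y^-1 ^+ k) = (fun y : R => y^-1) ^+ k.
      by apply/funext => y; rewrite exprfctE.
    exact: is_deriveX.
  have dE : is_derive x 1 (fun y : R => expR (- y^-1))
      (expR (- x^-1) * x ^- 2).
    rewrite -[X in _ * X]opprK.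
    exact: (@is_derive1_comp _ expR (fun y => - y^-1)).
  have dM := is_deriveM dX dE.
  apply: is_derive_eq; rewrite /flat x0 /GRing.scale/=.
  case: k {dX dM} => [|k] /=.
    by rewrite !expr0 !mul0r mulr0 addr0 subr0 mul1r mulrC.
  by rewrite !exprVn !exprS; field; rewrite ?expf_neq0.
- rewrite !flat_le0// mulr0 subr0.
  have [C C0 CE] := flat_bound k.
  have cv : (fun h => h^-1 *: ((flat k \o shift 0) (h *: 1) - flat k 0)) h
      @[h --> (0 : R)^'] --> (0 : R).
    apply/cvgrPdist_le => e e0; near=> h.
    have h0 : h != 0 by near: h; exact: nbhs_dnbhs_neq.
    rewrite sub0r normrN /= addr0 (flat_le0 k (lexx (0 : R))) subr0 normrZ normfV.
    rewrite [_ *: 1]mulr1 ler_pdivrMl ?normr_gt0// ger0_norm ?flat_ge0//.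
    rewrite (le_trans (CE h))// -real_normK ?num_real// expr2 mulrA mulrC.
    rewrite ler_wpM2l// -ler_pdivlMl//.
    by near: h; apply: dnbhs0_le; rewrite mulr_gt0// invr_gt0.
  apply: DeriveDef; first by apply/cvg_ex; exists 0.
  exact/cvg_lim.
Unshelve. all: by end_near. Qed.

(** The classical e^(-1/x) is not convex on the positive reals, but
    x e^(-1/x) is. The factor makes the value at 1 equal to 2. *)
Definition ramp (x : R) : R := 2 * expR 1 * (x * flat 0 x).

(** The derivative of [ramp]: that of x e^(-1/x) is (1 + 1/x) e^(-1/x). *)
Definition dramp (x : R) : R := 2 * expR 1 * (flat 0 x + flat 1 x).

Lemma flatS k x : x * flat k.+1 x = flat k x.
Proof.
rewrite /flat; case: ifPn => [x0|_]; last by rewrite mulr0.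
by rewrite exprS; field; rewrite expf_neq0 !gt_eqF.
Qed.

Lemma flat_continuous k : continuous (flat k).
Proof.
move=> x; apply: differentiable_continuous; apply/derivable1_diffP.
by have [] := is_derive_flat k x.
Qed.

Lemma ramp_continuous : continuous ramp.
Proof.
move=> x; apply: cvgM; first exact: cvg_cst.
by apply: cvgM; [exact: cvg_id|exact: flat_continuous].
Qed.

Lemma ramp_ge0 x : 0 <= ramp x.
Proof.
rewrite /ramp mulr_ge0//.
have [x0|x0] := leP x 0; first by rewrite flat_le0// mulr0.
by rewrite mulr_ge0 ?flat_ge0// ltW.
Qed.

Lemma ramp_le0 x : x <= 0 -> ramp x = 0.
Proof. by move=> x0; rewrite /ramp flat_le0// !mulr0. Qed.

Lemma ramp1 : ramp 1 = 2.
Proof.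
by rewrite /ramp /flat ltr01 expr0 !invr1 !mul1r -mulrA -expRD subrr expR0 mulr1.
Qed.

Lemma dramp_ge0 x : 0 <= dramp x.
Proof. by rewrite /dramp !mulr_ge0 ?addr_ge0 ?flat_ge0 ?expR_ge0. Qed.

(** Convexity in the form of supporting lines. For x > 0 the tangent at x is
    e^(-1/x) (y - 1 + y / x), so for y > 0 the claim reduces to
    1 + u <= e^u with u = 1/x - 1/y. *)
Lemma ramp_tangent x y : ramp x + dramp x * (y - x) <= ramp y.
Proof.
rewrite /ramp /dramp -!mulrA -!mulrDr ler_pM2l// ler_pM2l ?expR_gt0//.
have [x0|x0] := leP x 0.
  rewrite !(flat_le0 _ x0) mulr0 addr0 mul0r addr0.
  have [y0|y0] := leP y 0; first by rewrite flat_le0// mulr0.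
  by rewrite mulr_ge0 ?flat_ge0// ltW.
have xn0 : x != 0 by rewrite gt_eqF.
rewrite -(flatS 0 x).
pose E := expR (- x^-1).
have E0 : 0 < E by exact: expR_gt0.
have -> : x * (x * flat 1 x) + (x * flat 1 x + flat 1 x) * (y - x) =
    E * (y - 1 + y / x).
  by rewrite /flat x0 expr1 -/E; field.
have [y0|y0] := leP y 0.
  rewrite flat_le0// mulr0 pmulr_rle0//.
  by have : y / x <= 0 by [rewrite mulr_le0_ge0// invr_ge0 ltW]; lra.
rewrite /flat y0 expr0 invr1 mul1r.
have -> : expR (- y^-1) = E * expR (x^-1 - y^-1).
  by rewrite /E -expRD; congr expR; ring.
rewrite mulrCA ler_pM2l//.
apply: (@le_trans _ _ (y * (1 + (x^-1 - y^-1)))).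
  by rewrite !mulrDr mulrN mulfV ?gt_eqF//; lra.
by rewrite ler_pM2l// expR_ge1Dx.
Qed.

End flat.

(** * Differentials and locality of smoothness *)

Section differentials.
Context {R : realType}.

Lemma near_dist_le (V : normedModType R) (x : V) (e : R) :
  0 < e -> \forall y \near x, `|x - y| <= e.
Proof.
by move=> e0; apply: (@cvgr_dist_le _ _ _ (nbhs x) _ id x) => //; exact: cvg_id.
Qed.

Lemma is_diffP (V W : normedModType R) (f : V -> W) (x : V) (L : clinType V W) :
  is_diff x f L <-> forall e : R, 0 < e ->
    \forall y \near x, `|f y - f x - L (y - x)| <= e * `|y - x|.
Proof.
have key : (f \o shift x = cst (f x) + (L : V -> W) +o_ 0 id) <->
    forall e : R, 0 < e ->
    \forall y \near x, `|f y - f x - L (y - x)| <= e * `|y - x|.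
  split=> [/eqaddoP dF e e0|dF].
    rewrite (near_shift 0) subr0; have := dF e e0.
    apply: filterS => y /=.
    by rewrite !fctE /= addrK -addrA opprD addrA.
  apply/eqaddoP => e e0; have := dF e e0.
  rewrite (near_shift 0) subr0; apply: filterS => y /=.
  by rewrite !fctE /= addrK -addrA opprD addrA.
split=> [[df dfE]|dF].
  by apply/key; have := diff_locally df; rewrite dfE.
have dfL : 'd f x = L :> (V -> W).
  by apply: diff_unique; [exact: cts_fun|exact/key].
apply: DiffDef => //; apply/diff_locallyP; rewrite dfL; split; last exact/key.
exact: cts_fun.
Qed.

Lemma is_diff_unique (V W : normedModType R) (f : V -> W) (x : V)
    (L M : clinType V W) : is_diff x f L -> is_diff x f M -> L = M.
Proof. by move=> [_ fL] [_ fM]; apply: clin_eqP; rewrite -fL. Qed.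

Lemma near_is_diff (V W : normedModType R) (f g : V -> W) (x : V)
    (L : clinType V W) : (\forall y \near x, f y = g y) ->
  is_diff x f L -> is_diff x g L.
Proof.
move=> fg /is_diffP dF; apply/is_diffP => e e0.
near=> y; rewrite -(nbhs_singleton fg) -(near fg y)//; near: y; exact: dF.
Unshelve. all: by end_near. Qed.

End differentials.

Section class_C_local.
Context {R : realType} {V : normedModType R}.

Lemma class_C_eq n (W : normedModType R) (f g : V -> W) (U : set V) :
  open U -> {in U, f =1 g} -> class_C n f U -> class_C n g U.
Proof.
move=> oU fg; have nfg x : U x -> \forall y \near x, f y = g y.
  move=> Ux; near=> y; apply: fg; rewrite inE.
  by near: y; exact: open_nbhs_nbhs.
case: n => [cf x Ux|n [D [dD cD]]]; last first.
  by exists D; split=> // x Ux; apply: near_is_diff (nfg x Ux) (dD x Ux).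
rewrite /prop_for /continuous_at -(fg x) ?inE//.
by apply: cvg_trans (cf x Ux); apply: near_eq_cvg; exact: nfg.
Unshelve. all: by end_near. Qed.

Lemma class_C_sub n (W : normedModType R) (f : V -> W) (U U' : set V) :
  U' `<=` U -> class_C n f U -> class_C n f U'.
Proof.
elim: n W f => [|n ih] W f sU; first by move=> cf x /sU/cf.
by move=> [D [dD cD]]; exists D; split; [move=> x /sU/dD|exact: ih].
Qed.

(** Differentials are unique, so the ones given near each point glue. *)
Lemma class_C_local n (W : normedModType R) (f : V -> W) (U : set V) :
  open U -> (forall x, U x -> exists U', [/\ open U', U' x & class_C n f U']) ->
  class_C n f U.
Proof.
move=> oU; elim: n W f => [|n ih] W f locf.
  by move=> x /locf[U' [_ U'x cf]]; exact: cf.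
have Dx x : exists L : clinType V W, U x -> is_diff x f L.
  have [/locf[U' [_ U'x [D [dD _]]]]|nUx] := pselect (U x); last by exists 0.
  by exists (D x) => _; exact: dD.
pose D x := projT1 (cid (Dx x)).
have dD x : U x -> is_diff x f (D x) by exact: projT2 (cid (Dx x)).
exists D; split=> //; apply: ih => x Ux; have [U' [oU' U'x cU']] := locf x Ux.
exists (U' `&` U); split=> //; first exact: openI.
case: cU' => D' [dD' cD'].
apply: (@class_C_eq _ _ D'); first exact: openI.
  by move=> y /[!inE] -[U'y Uy]; apply: is_diff_unique (dD' y U'y) (dD y Uy).
by apply: class_C_sub cD'; exact: subIsetl.
Qed.

End class_C_local.

(** * Function classes closed under taking gradients *)

Lemma clin_sumE {R : realType} {V : normedModType R} (I : Type) (s : seq I)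
    (k : I -> R) (phi : I -> clinType V R^o) (x : V) :
  (\sum_(i <- s) k i *: phi i) x = \sum_(i <- s) k i * phi i x :> R.
Proof.
elim: s => [|i s ih]; first by rewrite !big_nil.
have clinDE (f g : clinType V R^o) : (f + g) x = f x + g x :> R by [].
by rewrite !big_cons clinDE ih.
Qed.

Section rank_one.
Context {R : realType} {V W : normedModType R}.

Lemma rank_one_subproof (phi : clinType V R^o) (w : W) :
  (fun x => phi x *: w) \in @clin_pred R V W.
Proof.
rewrite inE; split=> [a x y|x].
  by rewrite linearP scalerDl -scalerA.
apply: cvgZr_tmp; exact: cts_fun.
Qed.

Definition rank_one (phi : clinType V R^o) (w : W) : clinType V W :=
  clin_Sub (rank_one_subproof phi w).

Lemma rank_oneD phi psi w : rank_one (phi + psi) w = rank_one phi w + rank_one psi w.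
Proof. by apply: clin_eqP; apply/funext => x; exact: scalerDl. Qed.

Lemma rank_oneZ a phi w : rank_one (a *: phi) w = a *: rank_one phi w.
Proof. by apply: clin_eqP; apply/funext => x; rewrite /= -scalerA. Qed.

Lemma rank_one0 w : rank_one 0 w = 0.
Proof. by apply: clin_eqP; apply/funext => x; exact: scale0r. Qed.

End rank_one.

Section comb.
Context {R : realType} {V : normedModType R}.
Variable G : set (V -> R).

(** Finite linear combinations of vectors whose coefficients are functions in
    [G]. An inductive predicate avoids indexing the coefficients, and all
    operations below are then one-step inductions. *)
Inductive comb (W : lmodType R) : (V -> W) -> Prop :=
| comb0 : comb (fun=> 0)
| combS g w u : G g -> comb u -> comb (fun x => g x *: w + u x).

Lemma combD (W : lmodType R) (u v : V -> W) :
  comb u -> comb v -> comb (fun x => u x + v x).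
Proof.
move=> + cv; elim=> [|g w u' Gg _ ih]; first by under eq_fun do rewrite add0r.
by under eq_fun do rewrite -addrA; exact: combS.
Qed.

Lemma comb1 (W : lmodType R) g (w : W) : G g -> comb (fun x => g x *: w).
Proof.
move=> Gg; have := combS w Gg (comb0 W).
by under eq_fun do rewrite addr0.
Qed.

Lemma comb_map (W W' : lmodType R) (T : W -> W') (u : V -> W) :
  T 0 = 0 -> {morph T : x y / x + y} -> (forall a, {morph T : x / a *: x}) ->
  comb u -> comb (fun x => T (u x)).
Proof.
move=> T0 TD TZ; elim=> [|g w u' Gg _ ih].
  by under eq_fun do rewrite T0; exact: comb0.
by under eq_fun do rewrite TD TZ; exact: combS.
Qed.

Lemma comb_mul (W : lmodType R) h (u : V -> W) :
  (forall g, G g -> G (fun x => h x * g x)) ->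
  comb u -> comb (fun x => h x *: u x).
Proof.
move=> Gh; elim=> [|g w u' Gg _ ih].
  by under eq_fun do rewrite scaler0; exact: comb0.
under eq_fun do rewrite scalerDr scalerA.
by apply: (@combS _ (fun x => h x * g x)) => //; exact: Gh.
Qed.

Lemma comb_continuous (W : normedModType R) (u : V -> W) (x : V) :
  (forall g, G g -> {for x, continuous g}) -> comb u -> {for x, continuous u}.
Proof.
move=> Gc; elim=> [|g w u' Gg _ ih]; first exact: cvg_cst.
by apply: cvgD ih; apply: cvgZr_tmp; exact: Gc.
Qed.

Variable U : set V.

Hypothesis Ggrad : forall g, G g -> exists D : V -> clinType V R^o,
  comb D /\ forall x, U x -> is_diff x (g : V -> R^o) (D x).

(** The derivative of g *: w is the rank-one map h |-> Dg(h) *: w, so expanding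
    Dg over [G] shows that the differential of a combination with values in [W]
    is a combination with values in the linear maps from [V] to [W]. *)
Lemma comb_diff (W : normedModType R) (u : V -> W) : comb u ->
  exists D : V -> clinType V W, comb D /\ forall x, U x -> is_diff x u (D x).
Proof.
elim=> [|g w u' Gg _ [D [cD dD]]].
  exists (fun=> 0); split; first exact: comb0.
  move=> x _; exact: is_diff_cst.
have [E [cE dE]] := Ggrad Gg.
exists (fun x => rank_one (E x) w + D x); split.
  apply: combD cD; apply: (@comb_map _ _ (fun phi => rank_one phi w)) => //.
  - exact: rank_one0.
  - by move=> phi psi; exact: rank_oneD.
  - by move=> a phi; exact: rank_oneZ.
move=> x Ux; apply: is_diffD (dD x Ux).
have := dE x Ux => dg.
exact: (@is_diff_comp R V R^o W g (E x) (fun k => k *: w)).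
Qed.

(** The induction must range over all target spaces: one differentiation
    replaces [W] by a space of linear maps. *)
Lemma comb_class_C n (W : normedModType R) (u : V -> W) :
  comb u -> class_C n u U.
Proof.
elim: n W u => [|n ih] W u cu.
  move=> x Ux; have [D [_ /(_ x Ux) [du _]]] := comb_diff cu.
  exact: differentiable_continuous.
have [D [cD dD]] := comb_diff cu.
by exists D; split=> //; exact: ih.
Qed.

Lemma grad_closed_class_C n g : G g -> class_C n (g : V -> R^o) U.
Proof.
move=> /(@comb1 R^o g 1)/(comb_class_C n).
by under eq_fun do rewrite [_ *: _]mulr1.
Qed.

End comb.

Section elementary.
Context {R : realType} {V : normedModType R}.
Variables (N : V -> R) (U : set V).

(** This class is large enough to contain the coefficients of the gradient of an
    [N] that is defined implicitly by means of flat functions. Once the gradient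
    of [N] has its coefficients in the class, the class is closed under taking
    gradients, and so [N] is smooth. *)
Inductive elem : (V -> R) -> Prop :=
| elem_cst c : elem (fun=> c)
| elem_lin (phi : clinType V R^o) : elem phi
| elem_base : elem N
| elemD g h : elem g -> elem h -> elem (fun x => g x + h x)
| elemM g h : elem g -> elem h -> elem (fun x => g x * h x)
| elemV g : elem g -> (forall x, U x -> g x != 0) -> elem (fun x => (g x)^-1)
| elem_flat k g : elem g -> elem (fun x => flat k (g x)).

Lemma elemN g : elem g -> elem (fun x => - g x).
Proof.
move=> eg; under eq_fun do rewrite -mulN1r.
by apply: elemM eg; exact: elem_cst.
Qed.

Lemma elem_sum I (s : seq I) (g : I -> V -> R) :
  (forall i, elem (g i)) -> elem (fun x => \sum_(i <- s) g i x).
Proof.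
move=> eg; elim: s => [|i s ih].
  by under eq_fun do rewrite big_nil; exact: elem_cst.
by under eq_fun do rewrite big_cons; exact: elemD.
Qed.

Lemma elem_continuous g x : U x -> {for x, continuous N} -> elem g ->
  {for x, continuous g}.
Proof.
move=> Ux cN; elim=> {g} [c|phi||g h _ cg _ ch|g h _ cg _ ch|g _ cg gn0|k g _ cg].
- exact: cvg_cst.
- exact: cts_fun.
- exact: cN.
- exact: (@cvgD R R^o).
- exact: cvgM.
- by apply: cvgV => //; exact: gn0.
- by apply: continuous_comp => //; exact: flat_continuous.
Qed.

Lemma elem_comb_comp (g : V -> R) (p dp : R -> R) (D : V -> clinType V R^o) :
  elem (fun x => dp (g x)) ->
  (forall x, U x -> is_derive (g x) 1 p (dp (g x))) ->
  comb elem D -> (forall x, U x -> is_diff x (g : V -> R^o) (D x)) ->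
  exists D' : V -> clinType V R^o, comb elem D' /\
    forall x, U x -> is_diff x ((fun x => p (g x)) : V -> R^o) (D' x).
Proof.
move=> edp dpP cD dD; exists (fun x => dp (g x) *: D x); split.
  by apply: comb_mul => // h eh; exact: elemM.
move=> x Ux; have dg := dD x Ux.
have [dpx dE] := dpP x Ux.
have dfp : is_diff (g x) (p : R^o -> R^o) (fun h => h *: dp (g x)).
  apply: DiffDef; first exact/derivable1_diffP.
  by rewrite diff1E ?derive1E ?dE//; exact/derivable1_diffP.
have := is_diff_comp dg dfp.
by congr is_diff_def; apply/funext => y /=; exact: mulrC.
Qed.

Hypothesis Ngrad : exists D : V -> clinType V R^o,
  comb elem D /\ forall x, U x -> is_diff x (N : V -> R^o) (D x).

Lemma elem_grad g : elem g -> exists D : V -> clinType V R^o,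
  comb elem D /\ forall x, U x -> is_diff x (g : V -> R^o) (D x).
Proof.
elim=> {g} [c|phi||g h eg [D [cD dD]] eh [E [cE dE]]
  |g h eg [D [cD dD]] eh [E [cE dE]]|g eg [D [cD dD]] gn0|k g eg [D [cD dD]]].
- by exists (fun=> 0); split=> [|x _]; [exact: comb0|exact: is_diff_cst].
- exists (fun=> phi); split.
    have := comb1 phi (elem_cst 1).
    by under eq_fun do rewrite scale1r.
  move=> x _; apply/is_diffP => e e0; apply: nearW => y.
  by rewrite linearB subrr normr0 mulr_ge0// ltW.
- exact: Ngrad.
- exists (fun x => D x + E x); split; first exact: combD.
  by move=> x Ux; apply: is_diffD; [exact: dD|exact: dE].
- exists (fun x => g x *: E x + h x *: D x); split.
    by apply: combD; apply: comb_mul => // g' eg'; exact: elemM.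
  by move=> x Ux; exact: is_diffM (dD x Ux) (dE x Ux).
- apply: (elem_comb_comp (p := @GRing.inv R) (dp := fun z => - (z^-1 * z^-1))) cD dD.
    by apply: elemN; apply: elemM; exact: elemV.
  move=> x Ux; have gx0 := gn0 x Ux.
  apply: DeriveDef; first exact: derivableV.
  by rewrite deriveV// derive_id scaler1 expr2 invfM.
- apply: (elem_comb_comp (p := flat k)
      (dp := fun z => flat k.+2 z - k%:R * flat k.+1 z)) cD dD.
    apply: elemD; first exact: elem_flat.
    by apply: elemN; apply: elemM; [exact: elem_cst|exact: elem_flat].
  by move=> x Ux; exact: is_derive_flat.
Qed.

Lemma elem_class_C n g : elem g -> class_C n (g : V -> R^o) U.
Proof. by move=> eg; apply: (@grad_closed_class_C _ _ elem U) eg; exact: elem_grad. Qed.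

End elementary.

(** * Implicitly defined smooth norms *)

Section barrier.
Context {R : realType}.
Implicit Types t z y : R.

(** For 0 < t, an even convex function that vanishes for |z| <= 1 - t
    and exceeds 1 for 1 <= |z|. *)
Definition barrier t z : R := ramp ((z - 1 + t) / t) + ramp ((- z - 1 + t) / t).

Definition dbarrier t z : R :=
  t^-1 * (dramp ((z - 1 + t) / t) - dramp ((- z - 1 + t) / t)).

Lemma barrier_ge0 t z : 0 <= barrier t z.
Proof. by rewrite addr_ge0 ?ramp_ge0. Qed.

Lemma barrierN t z : barrier t (- z) = barrier t z.
Proof. by rewrite /barrier opprK addrC. Qed.

Lemma barrier_tangent t z y : barrier t z + dbarrier t z * (y - z) <= barrier t y.
Proof.
have := lerD (ramp_tangent ((z - 1 + t) / t) ((y - 1 + t) / t))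
  (ramp_tangent ((- z - 1 + t) / t) ((- y - 1 + t) / t)).
apply: le_trans; rewrite le_eqVlt; apply/orP; left; apply/eqP.
by rewrite /barrier /dbarrier; ring.
Qed.

Lemma barrier_eq0 t z : 0 < t -> `|z| <= 1 - t -> barrier t z = 0.
Proof.
move=> t0; rewrite ler_norml => /andP[z1 z2].
by rewrite /barrier !ramp_le0 ?addr0// pmulr_lle0 ?invr_gt0//; lra.
Qed.

Lemma barrier_gt1 t z : 0 < t -> 1 <= `|z| -> 1 < barrier t z.
Proof.
move=> t0; wlog z0 : z / 0 <= z.
  move=> H; have [|/ltW z0] := leP 0 z; first exact: H.
  by rewrite -(barrierN t z) -normrN; apply: H; rewrite oppr_ge0.
rewrite ger0_norm// => z1.
have : ramp 1 <= ramp ((z - 1 + t) / t).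
  apply: le_trans (ramp_tangent 1 _); rewrite lerDl mulr_ge0 ?dramp_ge0//.
  by rewrite subr_ge0 ler_pdivlMr//; lra.
by rewrite ramp1 /barrier; have := ramp_ge0 ((- z - 1 + t) / t); lra.
Qed.

Lemma barrier_convex t a b y z : 0 <= a -> 0 <= b -> a + b = 1 ->
  barrier t (a * y + b * z) <= a * barrier t y + b * barrier t z.
Proof.
move=> a0 b0 ab; set m := a * y + b * z.
have := lerD (ler_wpM2l a0 (barrier_tangent t m y))
  (ler_wpM2l b0 (barrier_tangent t m z)).
apply: le_trans; have bE : b = 1 - a by lra.
rewrite /m bE.
by rewrite le_eqVlt; apply/orP; left; apply/eqP; ring.
Qed.

Lemma barrier_continuous t : continuous (barrier t).
Proof.
move=> z; apply: (@cvgD R R^o).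
  apply: (@continuous_comp R R R (fun z => (z - 1 + t) / t) ramp); last first.
    exact: ramp_continuous.
  apply: cvgM; last exact: cvg_cst.
  by apply: (@cvgD R R^o); [apply: (@cvgB R R^o)|]; (exact: cvg_id || exact: cvg_cst).
apply: (@continuous_comp R R R (fun z => (- z - 1 + t) / t) ramp); last first.
  exact: ramp_continuous.
apply: cvgM; last exact: cvg_cst.
apply: (@cvgD R R^o); last exact: cvg_cst.
apply: (@cvgB R R^o); last exact: cvg_cst.
by apply: (@cvgN R R^o); exact: cvg_id.
Qed.

End barrier.

(** If finitely many functionals determine [N] on [U] through the equation
    sum_i barrier (l_i x / N x) = 1, then [N] is smooth on [U]. Differentiating
    the equation formally gives N x / q x *: sum_i w_i x *: l_i for the
    differential, where w_i is the derivative of the i-th term and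
    q = sum_i w_i l_i. Convexity takes the place of the implicit function
    theorem: this functional supports [N] at x, and a continuous choice of
    supporting functionals is a derivative. *)
Section implicit_norm.
Context {R : realType} {V : normedModType R} {I : Type}.
Variables (l : I -> clinType V R^o) (th : I -> R) (T : seq I) (N : V -> R).
Variable U : set V.
Hypothesis th_gt0 : forall i, 0 < th i.
Hypothesis th_le1 : forall i, th i <= 1.
Hypothesis Uopen : open U.
Hypothesis N_gt0 : forall x, U x -> 0 < N x.
Hypothesis N_continuous : forall x, U x -> {for x, continuous N}.

Let z i x := l i x / N x.
Hypothesis sum_barrier : forall x, U x -> \sum_(i <- T) barrier (th i) (z i x) = 1.

Let w i x := dbarrier (th i) (z i x).
Let q x := \sum_(i <- T) w i x * l i x.

(* The tangent at l_i x / N x, evaluated at 0, bounds each barrier. *)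
Let q_gt0 x : U x -> 0 < q x.
Proof.
move=> Ux; have N0 := N_gt0 Ux.
suff : 1 <= q x / N x by rewrite ler_pdivlMr// mul1r; exact: lt_le_trans.
rewrite -(sum_barrier Ux) mulr_suml; apply: ler_sum => i _.
have := barrier_tangent (th i) (z i x) 0; rewrite sub0r mulrN -/(w i x).
have -> : barrier (th i) 0 = 0 by apply: barrier_eq0; rewrite ?normr0 ?subr_ge0.
by rewrite subr_le0 /z mulrA.
Qed.

Definition implicit_diff (x : V) : clinType V R^o :=
  \sum_(i <- T) (w i x * (N x / q x)) *: l i.

Let implicit_diffE x y :
  implicit_diff x y = N x / q x * \sum_(i <- T) w i x * l i y :> R.
Proof.
rewrite /implicit_diff clin_sumE mulr_sumr; apply: eq_bigr => i _.
by rewrite mulrAC mulrC.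
Qed.

(** Add up the tangent inequalities at l_i x / N x. The two sums of barriers
    are both 1 and cancel. *)
Lemma implicit_diff_le x y : U x -> U y -> implicit_diff x y <= N y :> R.
Proof.
move=> Ux Uy; have N0 := N_gt0 Ux; have M0 := N_gt0 Uy; have q0 := q_gt0 Ux.
have : \sum_(i <- T) w i x * (z i y - z i x) <= 0.
  have S0 : \sum_(i <- T) barrier (th i) (z i y) -
      \sum_(i <- T) barrier (th i) (z i x) = 0.
    by rewrite !sum_barrier// subrr.
  rewrite -[leRHS]S0 -sumrB; apply: ler_sum => i _.
  by rewrite lerBrDl; exact: barrier_tangent.
under eq_bigr do rewrite mulrBr !mulrA.
rewrite sumrB -!mulr_suml subr_le0 -/(q x) => H.
rewrite implicit_diffE mulrAC ler_pdivrMr// -ler_pdivlMl//.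
have -> : (N x)^-1 * (N y * q x) = q x / N x * N y by ring.
by rewrite -ler_pdivrMr.
Qed.

Lemma implicit_diff_eq x : U x -> implicit_diff x x = N x :> R.
Proof. by move=> Ux; rewrite implicit_diffE divfK// gt_eqF ?q_gt0. Qed.

Lemma elem_dbarrier t g : elem N U g -> elem N U (fun x => dbarrier t (g x)).
Proof.
move=> eg; rewrite /dbarrier /dramp.
have e1 : elem N U (fun x => (g x - 1 + t) / t).
  apply: elemM; last exact: elem_cst.
  by apply: elemD; [apply: elemD => //; exact: elem_cst|exact: elem_cst].
have e2 : elem N U (fun x => (- g x - 1 + t) / t).
  apply: elemM; last exact: elem_cst.
  apply: elemD; last exact: elem_cst.
  apply: elemD; last exact: elem_cst.
  exact: elemN.
apply: elemM; first exact: elem_cst.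
apply: elemD.
  by apply: elemM; [exact: elem_cst|apply: elemD; exact: elem_flat].
apply: elemN; apply: elemM; first exact: elem_cst.
by apply: elemD; exact: elem_flat.
Qed.

Let elem_w i : elem N U (w i).
Proof.
apply: elem_dbarrier; apply: elemM; first exact: elem_lin.
apply: elemV; first exact: elem_base.
by move=> x /N_gt0; exact: lt0r_neq0.
Qed.

Lemma comb_implicit_diff : comb (elem N U) implicit_diff.
Proof.
have cq : elem N U (fun x => N x / q x).
  apply: elemM; first exact: elem_base.
  apply: elemV; last by move=> x /q_gt0; exact: lt0r_neq0.
  by apply: elem_sum => i; apply: elemM; [exact: elem_w|exact: elem_lin].
rewrite /implicit_diff; elim: (T) => [|i s ih].
  by under eq_fun do rewrite big_nil; exact: comb0.
under eq_fun do rewrite big_cons.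
apply: (@combS _ _ _ _ (fun x => w i x * (N x / q x))) => //.
by apply: elemM => //; exact: elem_w.
Qed.

(** Write D for the supporting functionals. Supporting at x gives
    0 <= N y - N x - D_x (y - x), and supporting at y bounds this by
    (D_y - D_x) (y - x), which is o(|y - x|) because D is continuous. *)
Lemma implicit_is_diff x : U x -> is_diff x (N : V -> R^o) (implicit_diff x).
Proof.
move=> Ux; apply/is_diffP => e e0.
have cD : {for x, continuous implicit_diff}.
  apply: comb_continuous comb_implicit_diff => g.
  by apply: elem_continuous => //; exact: N_continuous.
have nD : \forall y \near x, `|implicit_diff y - implicit_diff x| <= e.
  by move/cvgrPdistC_le : cD; exact.
near=> y.
have Uy : U y by near: y; apply: open_nbhs_nbhs; split.
have D0 : 0 <= N y - N x - implicit_diff x (y - x).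
  by rewrite linearB/= implicit_diff_eq// subr_ge0 lerD2r implicit_diff_le.
rewrite ger0_norm//.
apply: (@le_trans _ _ ((implicit_diff y - implicit_diff x) (y - x) : R)).
  rewrite -[leRHS]/(implicit_diff y (y - x) - implicit_diff x (y - x) : R).
  rewrite lerD2r linearB/= implicit_diff_eq// lerD2l lerN2.
  exact: implicit_diff_le.
apply: le_trans (ler_norm _) _; apply: le_trans (le_clin_norm _ _) _.
by rewrite ler_wpM2r//; near: y; exact: nD.
Unshelve. all: by end_near. Qed.

Lemma implicit_norm_class_C n : class_C n (N : V -> R^o) U.
Proof.
apply: (@elem_class_C _ _ N); last exact: elem_base.
by exists implicit_diff; split; [exact: comb_implicit_diff|exact: implicit_is_diff].
Qed.

End implicit_norm.

(** * The gauge of a locally finite sum of barriers *)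

Lemma ler_sum_uniq (R : realType) (I : choiceType) (s T : seq I) (F : I -> R) :
  (forall i, 0 <= F i) -> uniq s -> uniq T -> (forall i, i \notin T -> F i = 0) ->
  \sum_(i <- s) F i <= \sum_(i <- T) F i.
Proof.
move=> F0 us uT FT; rewrite (bigID (mem T))/= [X in _ + X]big1 ?addr0; last first.
  by move=> i; exact: FT.
rewrite -big_filter (perm_big [seq i <- T | i \in s]).
  by rewrite big_filter big_mkcond/= ler_sum// => i _; case: ifP.
by apply: uniq_perm; rewrite ?filter_uniq// => i; rewrite !mem_filter andbC.
Qed.

Section gauge.
Context {R : realType} {V : normedModType R} {I : choiceType}.
Variables (l : I -> clinType V R^o) (th : I -> R) (C c : R).
Hypotheses (C0 : 0 < C) (c0 : 0 < c).
Hypothesis l_le : forall i x, `|l i x| <= C * `|x|.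
Hypothesis l_norming : forall x M, 0 <= M -> (forall i, `|l i x| <= M) ->
  `|x| <= c * M.
Hypothesis th_gt0 : forall i, 0 < th i.
(* A bound below 1, uniform in i, makes the body a neighbourhood of 0. *)
Hypothesis th_le : forall i, th i <= 2^-1.

Definition barrier_sum (s : seq I) (x : V) : R := \sum_(i <- s) barrier (th i) (l i x).

(** Bounding all finite partial sums defines an infinite sum of nonnegative
    terms without summability conditions; uniqueness of the entries makes a
    list stand for a finite set. *)
Definition body (x : V) := forall s, uniq s -> barrier_sum s x <= 1.

Definition gauge (x : V) : R := inf [set a | 0 < a /\ body (a^-1 *: x)].

Let lZ i a x : l i (a *: x) = a * l i x :> R.
Proof. exact: linearZ. Qed.

Lemma barrier_sum_continuous s : continuous (barrier_sum s).
Proof.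
elim: s => [|i s ih].
  rewrite /barrier_sum; under [X in continuous X]eq_fun do rewrite big_nil.
  by move=> x; exact: cvg_cst.
rewrite /barrier_sum; under [X in continuous X]eq_fun do rewrite big_cons.
move=> x; apply: (@cvgD _ R^o); last exact: ih.
apply: (@continuous_comp _ R^o R^o (l i) (barrier (th i))); first exact: cts_fun.
exact: barrier_continuous.
Qed.

Lemma body_convex x y a b : 0 <= a -> 0 <= b -> a + b = 1 ->
  body x -> body y -> body (a *: x + b *: y).
Proof.
move=> a0 b0 ab Bx By s us.
apply: (@le_trans _ _ (a * barrier_sum s x + b * barrier_sum s y)).
  rewrite /barrier_sum !mulr_sumr -big_split ler_sum//= => i _.
  by rewrite linearD !linearZ; exact: barrier_convex.
rewrite -[leRHS]ab; apply: lerD.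
  by rewrite ler_piMr// Bx.
by rewrite ler_piMr// By.
Qed.

Lemma bodyN x : body x -> body (- x).
Proof.
move=> Bx s us; rewrite /barrier_sum; under eq_bigr do rewrite linearN barrierN.
exact: Bx.
Qed.

Lemma body_small x : (forall i, `|l i x| <= 2^-1) -> body x.
Proof.
move=> xl s us; rewrite /barrier_sum big1// => i _; apply: barrier_eq0 => //.
by rewrite (le_trans (xl i))//; have := th_le i; lra.
Qed.

Lemma body_scale a x : 0 <= a <= 1 -> body x -> body (a *: x).
Proof.
move=> /andP[a0 a1] Bx.
rewrite -[_ *: _]addr0 -[X in _ + X](scaler0 _ (1 - a)).
apply: body_convex => //; [by rewrite subr_ge0|by rewrite subrKC|].
by apply: body_small => i; rewrite linear0 normr0.
Qed.

Lemma body_lt1 x i : body x -> `|l i x| < 1.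
Proof.
move=> /(_ [:: i] isT); rewrite /barrier_sum big_seq1 => B; rewrite ltNge.
by apply/negP => /(barrier_gt1 (th_gt0 i)); rewrite ltNge B.
Qed.

Lemma gauge_mem x a : 0 < a -> 2 * C * `|x| <= a -> body (a^-1 *: x).
Proof.
move=> a0 xa; apply: body_small => i.
rewrite lZ normrM normfV (gtr0_norm a0) ler_pdivrMl//.
by rewrite (le_trans (l_le i x))// ler_pdivlMr// mulrC mulrA.
Qed.

Lemma gauge_has_inf x : has_inf [set a | 0 < a /\ body (a^-1 *: x)].
Proof.
split; last by exists 0 => a [/ltW].
exists (2 * C * `|x| + 1); split; first by rewrite ltr_wpDl// !mulr_ge0// ltW.
by apply: gauge_mem; rewrite ?lerDl// ltr_wpDl// !mulr_ge0// ltW.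
Qed.

Lemma gauge_le x a : 0 < a -> body (a^-1 *: x) -> gauge x <= a.
Proof. by move=> a0 Ba; apply: ge_inf; [exact: (gauge_has_inf x).2|]. Qed.

Lemma gauge_ge x M : (forall a, 0 < a -> body (a^-1 *: x) -> M <= a) -> M <= gauge x.
Proof.
by move=> H; apply: lb_le_inf (gauge_has_inf x).1 _ => a [a0 Ba]; exact: H.
Qed.

Lemma gauge_ge0 x : 0 <= gauge x.
Proof. by apply: gauge_ge => a /ltW. Qed.

Lemma gauge_lt x a : gauge x < a -> body (a^-1 *: x).
Proof.
move=> xa; have [b [b0 Bb] ba] := inf_lt (gauge_has_inf x).1 xa.
have -> : a^-1 *: x = (b / a) *: (b^-1 *: x).
  by rewrite scalerA mulrAC divff ?mul1r// gt_eqF.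
have a0 := lt_trans b0 ba.
by apply: body_scale Bb; rewrite divr_ge0 ?ler_pdivrMr ?mul1r ?ltW.
Qed.

Lemma gauge_upper x : gauge x <= 2 * C * `|x|.
Proof.
apply/ler_addgt0Pr => e e0; have p : 0 <= 2 * C * `|x| by rewrite !mulr_ge0// ltW.
by apply: gauge_le; [rewrite ltr_wpDl|apply: gauge_mem; rewrite ?ltr_wpDl// lerDl ltW].
Qed.

Lemma gauge_lower x : c^-1 * `|x| <= gauge x.
Proof.
apply: gauge_ge => a a0 Ba; rewrite ler_pdivrMl//; apply: l_norming (ltW a0) _ => i.
have := body_lt1 i Ba; rewrite lZ normrM normfV (gtr0_norm a0).
by rewrite ltr_pdivrMl// mulr1 => /ltW.
Qed.

Lemma gaugeD x y : gauge (x + y) <= gauge x + gauge y.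
Proof.
apply/ler_addgt0Pr => e e0; set a := gauge x + e / 2; set b := gauge y + e / 2.
have xa : gauge x < a by rewrite ltrDl divr_gt0.
have yb : gauge y < b by rewrite ltrDl divr_gt0.
have a0 : 0 < a := le_lt_trans (gauge_ge0 x) xa.
have b0 : 0 < b := le_lt_trans (gauge_ge0 y) yb.
have -> : gauge x + gauge y + e = a + b by rewrite /a /b; lra.
have ab : 0 < a + b by exact: addr_gt0.
apply: gauge_le => //.
have -> : (a + b)^-1 *: (x + y) =
    (a / (a + b)) *: (a^-1 *: x) + (b / (a + b)) *: (b^-1 *: y).
  by rewrite scalerDr !scalerA; congr (_ *: _ + _ *: _); field; rewrite !gt_eqF.
apply: body_convex; [exact: divr_ge0 (ltW _) (ltW _)|exact: divr_ge0 (ltW _) (ltW _)| |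
  exact: gauge_lt|exact: gauge_lt].
by rewrite -mulrDl divff// gt_eqF.
Qed.

Lemma gauge0 : gauge 0 = 0.
Proof.
by apply/eqP; rewrite eq_le gauge_ge0 andbT (le_trans (gauge_upper 0))// normr0 mulr0.
Qed.

Lemma gaugeZ_le a x : gauge (a *: x) <= `|a| * gauge x.
Proof.
have [->|a0] := eqVneq a 0; first by rewrite scale0r normr0 mul0r gauge0.
have na : 0 < `|a| by rewrite normr_gt0.
rewrite -ler_pdivrMl//; apply: gauge_ge => b b0 Bb.
rewrite ler_pdivrMl//; apply: gauge_le; first exact: mulr_gt0.
rewrite scalerA invfM mulrAC; have [p|p] := ltP 0 a.
  by rewrite gtr0_norm// mulVf// mul1r.
rewrite ler0_norm// invrN mulNr mulVf// mulN1r scaleNr; exact: bodyN.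
Qed.

Lemma gaugeZ a x : gauge (a *: x) = `|a| * gauge x.
Proof.
apply/eqP; rewrite eq_le gaugeZ_le/=.
have [->|a0] := eqVneq a 0; first by rewrite normr0 mul0r gauge_ge0.
rewrite -ler_pdivlMl ?normr_gt0// -normfV.
by rewrite (le_trans _ (gaugeZ_le _ _))// scalerA mulVf// scale1r.
Qed.

Lemma gauge_gt0 x : x != 0 -> 0 < gauge x.
Proof.
move=> x0; apply: lt_le_trans (gauge_lower x).
by rewrite mulr_gt0 ?invr_gt0// normr_gt0.
Qed.

Lemma gauge_equivalent : equivalent_norm gauge.
Proof.
split; first split; [exact: gaugeD|exact: gaugeZ| |].
  move=> x x0; apply/eqP; apply: contraT => /gauge_gt0.
  by rewrite x0 ltxx.
exists c^-1, (2 * C); split; rewrite ?invr_gt0 ?mulr_gt0// => x.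
by rewrite gauge_lower gauge_upper.
Qed.

Lemma gauge_lipschitz x y : `|gauge y - gauge x| <= 2 * C * `|y - x|.
Proof.
rewrite ler_norml; apply/andP; split.
  rewrite lerNl opprB lerBlDr -[X in gauge X <= _](subrK y) distrC.
  by rewrite (le_trans (gaugeD _ _))// lerD2r gauge_upper.
rewrite lerBlDr -[X in gauge X <= _](subrK x).
by rewrite (le_trans (gaugeD _ _))// lerD2r gauge_upper.
Qed.

Lemma gauge_continuous : continuous (gauge : V -> R^o).
Proof.
move=> x; apply/cvgrPdist_le => e e0; near=> y.
rewrite (le_trans (gauge_lipschitz y x))// -ler_pdivlMl ?mulr_gt0//.
near: y; apply: near_dist_le.
by rewrite mulr_gt0// invr_gt0 mulr_gt0.
Unshelve. all: by end_near. Qed.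

Lemma ray_continuous (x : V) : x != 0 ->
  {for gauge x, continuous (fun a : R => a^-1 *: x)}.
Proof.
move=> x0; apply: (@continuous_comp R R V (fun a => a^-1) (fun a => a *: x)).
  by apply: cvgV; [rewrite gt_eqF ?gauge_gt0|exact: cvg_id].
exact: scalel_continuous.
Qed.

(** The partial sums are continuous along the ray through x, so the infimum
    that defines the gauge is attained. *)
Lemma gauge_attained x : x != 0 -> body ((gauge x)^-1 *: x).
Proof.
move=> x0 s us; rewrite leNgt; apply/negP => B.
have cb : {for gauge x, continuous (fun a : R => barrier_sum s (a^-1 *: x))}.
  apply: (@continuous_comp R V R _ (barrier_sum s)); first exact: ray_continuous.
  exact: barrier_sum_continuous.
have [d /= d0 dB] := cvgr_gt _ cb _ B.
have xa : gauge x < gauge x + d / 2 by rewrite ltrDl divr_gt0.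
have := dB (gauge x + d / 2); rewrite /ball_ /= opprD addNKr normrN gtr0_norm ?divr_gt0//.
rewrite ltr_pdivrMr// ltr_pMr// ltr1n => /(_ isT).
by rewrite ltNge (gauge_lt xa us).
Qed.

Definition inactive (T : seq I) (y : V) :=
  forall i, i \notin T -> `|l i y| <= 1 - th i.

Lemma body_inactive T y : uniq T -> inactive T y -> barrier_sum T y <= 1 -> body y.
Proof.
move=> uT Ty Ty1 s us; apply: le_trans Ty1; apply: ler_sum_uniq => // i.
  exact: barrier_ge0.
by move=> /Ty; exact: barrier_eq0.
Qed.

(** Near the normalised point only the terms in [T] count, so a sum smaller
    than 1 would leave room to shrink the gauge. *)
Lemma gauge_boundary T x : uniq T -> x != 0 ->
  (\forall y \near (gauge x)^-1 *: x, inactive T y) ->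
  barrier_sum T ((gauge x)^-1 *: x) = 1.
Proof.
move=> uT x0 nT; apply/eqP; rewrite eq_le gauge_attained//= leNgt; apply/negP => T1.
have nT1 := cvgr_lt _ (@barrier_sum_continuous T ((gauge x)^-1 *: x)) _ T1.
have nB : \forall y \near (gauge x)^-1 *: x, body y.
  near=> y; apply: (@body_inactive T) => //; first by near: y.
  by apply: ltW; near: y; exact: nT1.
have [d /= d0 dB] := ray_continuous x0 nB.
have g0 := gauge_gt0 x0; pose e := Num.min (d / 2) (gauge x / 2).
have e0 : 0 < e by rewrite lt_min !divr_gt0.
have ed : e < d.
  by rewrite (@le_lt_trans _ _ (d / 2)) ?ge_min ?lexx// gtr_pMr// invf_lt1// ltr1n.
have eg : e < gauge x.
  rewrite (@le_lt_trans _ _ (gauge x / 2)) ?ge_min ?lexx ?orbT//.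
  by rewrite gtr_pMr// invf_lt1// ltr1n.
have := dB (gauge x - e); rewrite /ball_ /= opprB addrC subrK gtr0_norm// => /(_ ed).
rewrite -subr_gt0 in eg; move=> /(gauge_le eg).
by move: e0; lra.
Unshelve. all: by end_near. Qed.

Section local.
Variable T : seq I.
Hypothesis uT : uniq T.

(** Requiring inactivity near the normalised point, rather than at it, makes
    the cell open and lets the previous lemma apply at each of its points. *)
Definition cell : set V :=
  [set x | x != 0 /\ \forall y \near (gauge x)^-1 *: x, inactive T y].

Lemma normalize_continuous x : x != 0 ->
  {for x, continuous (fun x => (gauge x)^-1 *: x)}.
Proof.
move=> x0; apply: (@cvgZ R V); last exact: cvg_id.
by apply: cvgV; [rewrite gt_eqF ?gauge_gt0|exact: gauge_continuous].
Qed.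

Lemma cell_open : open cell.
Proof.
rewrite openE => x [x0 nT].
have nn0 : \forall y \near x, y != 0.
  have := @gauge_continuous x; move=> /cvgr_gt/(_ _ (gauge_gt0 x0)).
  apply: filterS => y; apply: contraTneq => ->; by rewrite gauge0 ltxx.
have := near_join nT => /(normalize_continuous x0) nT'.
by near=> y; split; [near: y|near: y].
Unshelve. all: by end_near. Qed.

Lemma cell_barrier_sum x : cell x ->
  \sum_(i <- T) barrier (th i) (l i x * (gauge x)^-1) = 1.
Proof.
move=> [x0 /(gauge_boundary uT x0) <-].
by apply: eq_bigr => i _; rewrite lZ mulrC.
Qed.

Lemma gauge_class_C_cell n : class_C n (gauge : V -> R^o) cell.
Proof.
apply: (@implicit_norm_class_C _ _ _ l th T) => //.
- by move=> i; rewrite (le_trans (th_le i))// invf_le1// ler1n.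
- exact: cell_open.
- by move=> x [x0 _]; exact: gauge_gt0.
- by move=> x _; exact: gauge_continuous.
- exact: cell_barrier_sum.
Qed.

End local.

Hypothesis locally_finite : forall x, (forall i, `|l i x| < 1) ->
  exists T : seq I, \forall y \near x, inactive T y.

(** A point of the body has all |l_i x| < 1, since barriers exceed 1 at 1.
    Hence local finiteness is available at every normalised point, and the
    cells cover the complement of 0. *)
Lemma gauge_class_Coo : class_Coo (gauge : V -> R^o) [set x | x != 0].
Proof.
move=> n; apply: class_C_local.
  have -> : [set x : V | x != 0] = gauge @^-1` [set a | a != 0].
    apply/seteqP; split=> x /=; first by move=> /gauge_gt0 g0; rewrite gt_eqF.
    by apply: contra_neq => ->; exact: gauge0.
  apply: open_comp; last exact: open_neq.
  by move=> x _; exact: gauge_continuous.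
move=> x x0; have [i|T nT] := locally_finite (x := (gauge x)^-1 *: x).
  by apply: body_lt1; exact: gauge_attained.
exists (cell (undup T)); split.
- exact: cell_open.
- split=> //; move: nT; apply: filterS => y Ty i; rewrite mem_undup; exact: Ty.
- by apply: gauge_class_C_cell; exact: undup_uniq.
Qed.

End gauge.

(** * Dual norms and evaluation functionals *)

(** Otherwise some sequence in [A] would satisfy the hypothesis of local uniform
    rotundity at [y] without converging to [y]. *)
Lemma LUR_gap (R : realType) (Y : lmodType R) (N : Y -> R) (A : set Y) (y : Y) d :
  LUR N -> (forall u v, N (u + v) <= N u + N v) -> N y = 1 -> 0 < d ->
  (forall u, A u -> N u = 1 /\ d <= N (u - y)) ->
  exists2 e, 0 < e & forall u, A u -> N (y + u) <= 2 - e.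
Proof.
move=> lur ND Ny d0 Ad; apply: contrapT => /forall2NP noe.
have ex n : exists u, A u /\ 2 - n.+1%:R^-1 < N (y + u).
  have [|/existsNP[u /not_implyP[Au /negP]]] := noe n.+1%:R^-1.
    by rewrite invr_gt0 ltr0n.
  by rewrite -ltNge => Nu; exists u.
pose u_ n := projT1 (cid (ex n)).
have uP n : A (u_ n) /\ 2 - n.+1%:R^-1 < N (y + u_ n) by exact: projT2 (cid (ex n)).
have : N (y + u_ n) @[n --> \oo] --> (2 : R).
  apply: (@squeeze_cvgr _ _ _ _ (fun n => 2 - n.+1%:R^-1) (fun=> 2)).
  - apply: nearW => n; rewrite ltW ?(uP n).2//=.
    by rewrite (le_trans (ND _ _))// Ny (Ad _ (uP n).1).1 -natr1.
  - rewrite -[X in _ --> X]subr0; apply: cvgB; first exact: cvg_cst.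
    exact: cvg_harmonic.
  - exact: cvg_cst.
move=> /(lur _ _ Ny (fun n => (Ad _ (uP n).1).1))/cvgr_lt/(_ _ d0)[n _ /(_ n)].
by move=> /(_ (leqnn n))/=; rewrite ltNge (Ad _ (uP n).1).2.
Qed.

Lemma contraction_clin (R : realType) (V : normedModType R) (phi : V -> R^o) :
  linear phi -> (forall x, `|phi x| <= `|x|) -> phi \in @clin_pred R V R^o.
Proof.
move=> lphi phi1; rewrite inE; split=> // x; apply/cvgrPdist_le => e e0; near=> y.
have -> : phi x - phi y = phi (x - y).
  by rewrite [x - y]addrC -[in RHS]scaleN1r lphi scaleN1r addrC.
by rewrite (le_trans (phi1 _)).
Unshelve. all: by end_near. Qed.

Section dual_norm.
Context {R : realType} {V : normedModType R}.
Variable N : V -> R.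
Hypothesis Neq : equivalent_norm N.
Implicit Types phi psi : clinType V R^o.

Let N0 : N 0 = 0.
Proof. by have [[_ NZ _] _] := Neq; rewrite -(scale0r 0) NZ normr0 mul0r. Qed.

Lemma dual_norm_has_sup phi : has_sup [set `|phi x| | x in [set x | N x <= 1]].
Proof.
split; first by exists `|phi 0|, 0 => //=; rewrite N0.
have [_ [c [C [c0 C0 cC]]]] := Neq; have [M M0 phiM] := clin_bound phi.
exists (M / c) => _ [x /= x1 <-]; rewrite (le_trans (phiM x))// ler_wpM2l//.
rewrite -[c^-1]mulr1 ler_pdivlMl// (le_trans _ x1)//.
by have /andP[] := cC x.
Qed.

Lemma le_dual_norm phi x : N x <= 1 -> phi x <= dual_norm N phi :> R.
Proof.
move=> x1; apply: le_trans (ler_norm _) _.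
by apply: (ub_le_sup (dual_norm_has_sup phi).2); exists x.
Qed.

Lemma dual_norm_le phi M : (forall x, N x <= 1 -> phi x <= M :> R) ->
  dual_norm N phi <= M.
Proof.
move=> phiM; apply: ge_sup; first exact: (dual_norm_has_sup phi).1.
move=> _ [x /= x1 <-]; rewrite ler_norml phiM// andbT lerNl -linearN phiM//.
by have [[_ NZ _] _] := Neq; rewrite -scaleN1r NZ normrN1 mul1r.
Qed.

Lemma dual_norm_lt phi m : m < dual_norm N phi ->
  exists2 x, N x <= 1 & m < phi x :> R.
Proof.
move=> mphi; apply: contrapT => nx.
suff : dual_norm N phi <= m by rewrite leNgt mphi.
apply: dual_norm_le => x x1; rewrite leNgt; apply/negP => mx.
by apply: nx; exists x.
Qed.

Lemma dual_normD phi psi :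
  dual_norm N (phi + psi) <= dual_norm N phi + dual_norm N psi.
Proof.
apply: dual_norm_le => x x1.
by apply: (@lerD R); exact: le_dual_norm.
Qed.

Lemma dual_normZ k phi : 0 < k -> dual_norm N (k *: phi) = k * dual_norm N phi.
Proof.
move=> k0; apply/eqP; rewrite eq_le; apply/andP; split.
  apply: dual_norm_le => x x1; rewrite -[leLHS]/(k * phi x).
  by rewrite ler_pM2l// le_dual_norm.
rewrite -ler_pdivlMl//; apply: dual_norm_le => x x1.
by rewrite ler_pdivlMl// -[leLHS]/((k *: phi) x : R) le_dual_norm.
Qed.

End dual_norm.

Section evaluation.
Context {R : realType} {K : topologicalType} (cK : compact [set: K]).
Local Notation CK := (cspace R cK).

Definition cspace_of (f : K -> R) (cf : continuous f) : CK := cts_Sub (mem_set cf).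

Lemma point_eval_subproof (t : K) : (fun f : CK => f t : R^o) \in @clin_pred R CK R^o.
Proof.
by apply: contraction_clin => // f; exact: (le_supnorm f).
Qed.

Definition point_eval (t : K) : clinType CK R^o := clin_Sub (point_eval_subproof t).

Lemma separating_function (hK : hausdorff_space K) (s t : K) : s != t ->
  exists g : CK, [/\ g s = 0, g t = 1 & `|g| <= 1].
Proof.
move=> st; have cr : completely_regular_space K.
  apply: (@normal_completely_regular R); first exact: compact_normal.
  exact: hausdorff_accessible.
have clt : closed [set t] by exact/accessible_closed_set1/hausdorff_accessible.
have nst : ~ [set t] s by move=> stE; move: st; rewrite stE eqxx.
have /(@uniform_separatorP _ R)[g [cg g01 gs gt]] := cr s [set t] clt nst.
exists (cspace_of cg); split.
- by apply: gs; exists s.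
- by apply: gt; exists t.
apply: supnorm_le => // x; have /= := g01 _ (imageT g x).
by rewrite in_itv/= => /andP[g0 g1]; rewrite ger0_norm.
Qed.

End evaluation.

(** * Evaluations under a dual locally uniformly rotund norm *)

Section dual_LUR.
Context {R : realType} {K : topologicalType}.
Hypotheses (hK : hausdorff_space K) (cK : compact [set: K]).
Local Notation CK := (cspace R cK).
Variable N : CK -> R.
Hypotheses (Neq : equivalent_norm N) (Nlur : LUR (dual_norm N)).

Definition weight (t : K) : R := dual_norm N (point_eval cK t).

Definition neval (t : K) : clinType CK R^o := (weight t)^-1 *: point_eval cK t.

Let nevalE t (f : CK) : neval t f = f t / weight t :> R.
Proof. by rewrite -[LHS]/((weight t)^-1 * f t) mulrC. Qed.

Lemma weight_bounds : exists c C : R, [/\ 0 < c, 0 < C &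
  forall t, c <= weight t <= C].
Proof.
have [_ [c [C [c0 C0 cC]]]] := Neq; exists C^-1, c^-1; split; rewrite ?invr_gt0// => t.
apply/andP; split.
  have cst_cts : continuous (fun _ : K => C^-1) by move=> x; exact: cvg_cst.
  apply: (@le_dual_norm _ _ N Neq (point_eval cK t) (cspace_of cK cst_cts)).
  have /andP[_ /le_trans] := cC (cspace_of cK cst_cts); apply.
  rewrite -ler_pdivlMl// mulr1; apply: supnorm_le => [|x].
    by rewrite invr_ge0 ltW.
  by rewrite gtr0_norm// invr_gt0.
apply: dual_norm_le => // f f1; apply: le_trans (ler_norm _) _.
apply: le_trans (le_supnorm f t) _; rewrite -[c^-1]mulr1 ler_pdivlMl//.
by have /andP[cf _] := cC f; exact: le_trans cf f1.
Qed.

Lemma weight_gt0 t : 0 < weight t.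
Proof.
have [c [C [c0 _ /(_ t)/andP[ct _]]]] := weight_bounds; exact: lt_le_trans ct.
Qed.

Lemma dual_norm_neval t : dual_norm N (neval t) = 1.
Proof.
by rewrite /neval dual_normZ ?invr_gt0 ?weight_gt0// mulVf// gt_eqF ?weight_gt0.
Qed.

(** A function equal to 0 at s and to 1 at t shows that the normalised
    evaluations are uniformly separated, so rotundity at the evaluation at t
    yields a gap that depends on t only. *)
Lemma neval_gap t : exists2 e : R, 0 < e <= 2^-1 &
  forall s, s != t -> dual_norm N (neval t + neval s) <= 2 - 2 * e.
Proof.
have [_ [c [C [_ C0 cC]]]] := Neq; have at0 := weight_gt0 t.
have [||e e0 eP] := LUR_gap (A := [set neval s | s in [set s | s != t]])
    (d := (C * weight t)^-1) Nlur (dual_normD Neq) (dual_norm_neval t).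
- by rewrite invr_gt0 mulr_gt0.
- move=> _ [s /= st <-]; split; first exact: dual_norm_neval.
  have [g [gs gt g1]] := separating_function (R := R) cK hK st.
  pose f : CK := - (C^-1 *: g).
  have fE x : f x = - (C^-1 * g x) by [].
  have <- : (neval s - neval t) f = (C * weight t)^-1 :> R.
    rewrite -[LHS]/(neval s f - neval t f : R) !nevalE !fE gs gt.
    by rewrite mulr0 oppr0 mul0r sub0r mulr1 mulNr opprK invfM.
  apply: (le_dual_norm Neq); have /andP[_ /le_trans] := cC f; apply.
  by rewrite normrN normrZ gtr0_norm ?invr_gt0// mulrA divff ?mul1r// gt_eqF.
exists (Num.min (e / 2) 2^-1).
  by rewrite lt_min divr_gt0// invr_gt0 ltr0n/= ge_min lexx orbT.
move=> s st; have /eP/le_trans : [set neval s | s in [set s | s != t]] (neval s).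
  by exists s.
apply; rewrite lerB// -ler_pdivlMl// mulrC.
by rewrite ge_min lexx.
Qed.

Definition gap t : R := projT1 (cid2 (neval_gap t)).

Lemma gap_bounds t : 0 < gap t <= 2^-1.
Proof. by rewrite /gap; case: cid2. Qed.

Lemma gapP t s : s != t -> dual_norm N (neval t + neval s) <= 2 - 2 * gap t.
Proof. by rewrite /gap; case: cid2 => /= e _; apply. Qed.

(** Let a and b be the weights of s and t, let r < 1 be the value of |f| at s
    relative to a, and suppose that |h| exceeds (1 - gap t) b at some t near
    s and h near f. Take g in the unit ball nearly norming the evaluation at s.
    As b is almost at least a, and |h t| is almost at most r a, the gap of t is
    bounded below in terms of 1 - r. On the other hand a / b is at least
    1 - gap t, so g makes the sum of the two normalised evaluations larger than
    2 - 2 * gap t unless gap t is small. With k = (1 - r) / 5 as tolerance the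
    two conclusions are 2 * k < gap t and gap t < 2 * k. *)
Lemma neval_isolated (f : CK) (s : K) : `|neval s f| < 1 ->
  \forall t \near s & h \near f, t <> s -> `|neval t h| <= 1 - gap t.
Proof.
move=> fs1; have as0 := weight_gt0 s; set a := weight s in as0 *.
set r := `|neval s f| in fs1 *.
have fsE : `|f s| = r * a.
  by rewrite /r nevalE normrM normfV (gtr0_norm as0) divfK// gt_eqF.
have r0 : 0 <= r by exact: normr_ge0.
pose k := (1 - r) / 5; have k0 : 0 < k by rewrite divr_gt0// subr_gt0.
have k1 : k < 1 by rewrite /k; lra.
have [g g1 gs] : exists2 g : CK, N g <= 1 & (1 - k) * a < g s.
  by apply: (@dual_norm_lt _ _ N Neq (point_eval cK s)); rewrite gtr_pMl//; lra.
have ng : \forall t \near s, (1 - k) * a < g t.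
  apply: cvgr_gt gs; exact: (@cts_fun _ _ (g : continuousType K R)).
have nf : \forall t \near s, `|f t| < (r + k) * a.
  have H : `|f s| < (r + k) * a by rewrite fsE ltr_pM2r// ltrDl.
  apply: cvgr_lt H; apply: cvg_norm.
  exact: (@cts_fun _ _ (f : continuousType K R)).
have nh : \forall h \near f, `|f - h| <= k * a.
  by apply: near_dist_le; rewrite mulr_gt0.
near=> t h => ts; rewrite leNgt; apply/negP => ht.
set d := gap t in ht *; have d0 : 0 < d by have /andP[] := gap_bounds t.
have b0 := weight_gt0 t; set b := weight t in b0 *; pose u := a / b.
have u0 : 0 < u by rewrite divr_gt0.
have gt : (1 - k) * a < g t by near: t.
have gu : (1 - k) * u < g t / b by rewrite mulrA ltr_pM2r ?invr_gt0.
have gb : g t / b <= 1.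
  by rewrite ler_pdivrMr// mul1r; exact: (@le_dual_norm _ _ N Neq (point_eval cK t) g g1).
have sep : g t / b + g s / a <= 2 - 2 * d.
  have st : s != t by apply/eqP => st; exact: ts.
  apply: le_trans (gapP st).
  have := @le_dual_norm _ _ N Neq (neval t + neval s) g g1; apply: le_trans.
  by rewrite -[leRHS]/(neval t g + neval s g : R) !nevalE.
have gsk : 1 - k < g s / a by rewrite ltr_pdivlMr.
have hu : 1 - d < (1 - 3 * k) * u.
  apply: (lt_le_trans ht); rewrite nevalE normrM normfV (gtr0_norm b0) mulrA.
  rewrite ler_pM2r ?invr_gt0//.
  have -> : (1 - 3 * k) * a = (r + k) * a + k * a by rewrite /k; field.
  have -> : h t = f t - (f - h) t by rewrite -[(f - h) t]/(f t - h t) subKr.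
  apply: le_trans (ler_normB _ _) _; apply: lerD.
    by apply: ltW; near: t.
  by apply: le_trans (le_supnorm (f - h) t) _; near: h.
have k3 : 0 < 1 - 3 * k by rewrite /k; lra.
have kd : 0 < k * d by rewrite mulr_gt0.
(* Lower weight bound at t and upper bound on h give 2 * k < d; the gap
   inequality gives d < 2 * k. *)
have p1 : (1 - k) * (1 - d) <= (1 - k) * u.
  apply: ler_wpM2l; first lra.
  by apply: le_trans (ltW hu) _; rewrite ler_piMl ?ltW//; lra.
have p2 : (1 - 3 * k) * ((1 - k) * u) <= (1 - 3 * k) * 1.
  by apply: ler_wpM2l; lra.
have p3 : (1 - k) * (1 - d) <= (1 - k) * ((1 - 3 * k) * u).
  by apply: ler_wpM2l; lra.
lra.
Unshelve. all: by end_near. Qed.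

(** Compactness: each s has a neighbourhood on which s itself is the only
    possible exception, so finitely many points suffice. The covering principle
    is applied to pairs of a finite set of exceptions, directed by inclusion,
    and a function near f. *)
Lemma neval_locally_finite (f : CK) : (forall t, `|neval t f| < 1) ->
  exists T : seq K, \forall h \near f, forall t, t \notin T ->
    `|neval t h| <= 1 - gap t.
Proof.
move=> f1.
pose F := filter_from [set: seq K] (fun A => [set B : seq K | {subset A <= B}]).
have FF : Filter F.
  apply: filter_from_filter; first by exists [::].
  move=> A B _ _ /=; exists (A ++ B : seq K) => // S AB; split=> x xA; apply: AB;
    by rewrite mem_cat xA ?orbT.
pose P (i : seq K * CK) (t : K) := t \notin i.1 -> `|neval t i.2| <= 1 - gap t.
have loc s : [set: K] s -> \forall t \near s & i \near filter_prod F (nbhs f), P i t.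
  move=> _; have [[A B] /= [As Bf] AB] := neval_isolated (f1 s).
  exists (A, [set i : seq K * CK | s \in i.1 /\ B i.2]) => /=.
    split=> //; exists ([set S : seq K | s \in S], B) => /=.
      by split=> //; exists [:: s] => // S /(_ s); rewrite inE eqxx; exact.
    by move=> [S h] [].
  move=> [t [S h]] /= [At [sS Bh]] tS; apply: (AB (t, h)) => //= ts.
  by move: tS; rewrite /= ts sS.
have FP : Filter (filter_prod F (nbhs f)) by exact: filter_prod_filter.
have := (compact_near_coveringP [set: K]).1 cK _ _ P FP loc.
move=> [[A B] /= [[T _ TA] Bf] AB]; exists T.
apply: filterS Bf => h Bh t tT; apply: (AB (T, h)) => //.
by split=> //; apply: TA.
Qed.

End dual_LUR.

Theorem theorem2 (R : realType) (K : topologicalType)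
  (hK : hausdorff_space K) (cK : compact [set: K]) :
  (exists N : cspace R cK -> R, equivalent_norm N /\ LUR (dual_norm N)) ->
  exists N : cspace R cK -> R,
    equivalent_norm N /\ class_Coo (W := R^o) N [set f : cspace R cK | f != 0].
Proof.
move=> [N [Neq Nlur]]; have [c [C [c0 C0 cC]]] := weight_bounds Neq.
have aB t : 0 < weight N t by exact: weight_gt0.
pose th := gap hK Neq Nlur.
have th0 t : 0 < th t by have /andP[] := gap_bounds hK Neq Nlur t.
have th2 t : th t <= 2^-1 by have /andP[] := gap_bounds hK Neq Nlur t.
have l_le t f : `|neval N t f| <= c^-1 * `|f|.
  rewrite -[neval N t f]/((weight N t)^-1 * f t) normrM normfV (gtr0_norm (aB t)).
  apply: ler_pM; rewrite ?invr_ge0 ?(ltW (aB t))//; last exact: le_supnorm.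
  by rewrite lef_pV2 ?posrE//; have /andP[] := cC t.
have l_norming f M : 0 <= M -> (forall t, `|neval N t f| <= M) -> `|f| <= C * M.
  move=> M0 fM; apply: supnorm_le => [|t]; first by rewrite mulr_ge0// ltW.
  have := fM t; rewrite -[neval N t f]/((weight N t)^-1 * f t).
  rewrite normrM normfV (gtr0_norm (aB t)) ler_pdivrMl// => /le_trans; apply.
  by rewrite ler_wpM2r//; have /andP[] := cC t.
have c'0 : 0 < c^-1 by rewrite invr_gt0.
exists (gauge (neval N) th); split; first exact: (gauge_equivalent c'0 C0).
apply: (gauge_class_Coo c'0 C0 l_le l_norming th0 th2).
exact: neval_locally_finite.
Qed.
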